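(* Let $\pi$ be a set of primes and let $\mathfrak{F}$ be a formation such that $\mathfrak{F}=\mathtt{S}\mathfrak{F}$. Then $\mathcal{N}_{\pi'\mathfrak{F}}^{\infty}(G)=Z_{\pi(\mathfrak{N}\circ\mathfrak{F})}(G)$ holds for every group $G\in \mathfrak{S}_{\pi}\circ\mathfrak{F}$.
   Context: All groups are finite; classes of groups are non-empty and closed under isomorphism. $\mathbb{P}$ is the set of all primes and $\pi'=\mathbb{P}\setminus\pi$. Classes: $\mathfrak{N}$ nilpotent groups; $\mathfrak{S}_\pi$ $\pi$-solvable groups (every chief factor is either a $\pi'$-group or a $p$-group for some $p\in\pi$). A formation is a class closed under homomorphic images and subdirect products. $G^{\mathfrak{F}}$ is the smallest normal subgroup $N$ of $G$ with $G/N\in\mathfrak{F}$. For a class $\mathfrak{X}$ and a formation $\mathfrak{F}$, $\mathfrak{X}\circ\mathfrak{F}=\{G: G^{\mathfrak{F}}\in\mathfrak{X}\}$. $\mathfrak{F}=\mathtt{S}\mathfrak{F}$ means $\mathfrak{F}$ is closed under subgroups. The $\pi'\mathfrak{F}$-norm of $G$ is $\mathcal{N}_{\pi'\mathfrak{F}}(G)=\bigcap_{H\leq G}N_G(H^{\mathfrak{F}}O_{\pi'}(G))$. Put $\mathcal{N}^0_{\pi'\mathfrak{F}}(G)=1$ and $\mathcal{N}^{i}_{\pi'\mathfrak{F}}(G)/\mathcal{N}^{i-1}_{\pi'\mathfrak{F}}(G)=\mathcal{N}_{\pi'\mathfrak{F}}(G/\mathcal{N}^{i-1}_{\pi'\mathfrak{F}}(G))$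 for $i\ge1$; $\mathcal{N}^{\infty}_{\pi'\mathfrak{F}}(G)$ is the terminal term of this ascending series. For a formation $\mathfrak{M}$, a chief factor $L/K$ of $G$ is $\mathfrak{M}$-central in $G$ if $(L/K)\rtimes(G/C_G(L/K))\in\mathfrak{M}$. A normal subgroup $N$ of $G$ is $\pi\mathfrak{M}$-hypercentral in $G$ if $N=1$, or $N>1$ and every chief factor of $G$ below $N$ of order divisible by at least one prime in $\pi$ is $\mathfrak{M}$-central in $G$. $Z_{\pi\mathfrak{M}}(G)$ is the product of all $\pi\mathfrak{M}$-hypercentral normal subgroups of $G$; $Z_{\pi(\mathfrak{N}\circ\mathfrak{F})}(G)$ is this subgroup for $\mathfrak{M}=\mathfrak{N}\circ\mathfrak{F}$. *)

(* Defs.v *)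
From HB Require Import structures.
From mathcomp Require Import all_boot all_fingroup all_solvable.
From mathcomp Require Import boolp.

Set Implicit Arguments.
Unset Strict Implicit.
Unset Printing Implicit Defensive.

Import GroupScope.

Definition group_family := forall gT : finGroupType, {group gT} -> Prop.

Definition group_class (X : group_family) : Prop :=
  (exists (gT : finGroupType) (G : {group gT}), X gT G) /\
  (forall (gT rT : finGroupType) (G : {group gT}) (H : {group rT}),
     G \isog H -> X gT G -> X rT H).

(* Closure under binary subdirect products suffices for all finite ones; the
   empty product is trivial, hence an image of any member of F. *)
Definition formation (F : group_family) : Prop :=
  [/\ group_class F,
      forall (gT rT : finGroupType) (G : {group gT})
             (f : {morphism G >-> rT}), F gT G -> F rT (f @* G)%G
    & forall (gT1 gT2 : finGroupType) (G1 : {group gT1}) (G2 : {group gT2})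
             (H : {group gT1 * gT2}),
        F gT1 G1 -> F gT2 G2 ->
        (@fst gT1 gT2) @* H = G1 -> (@snd gT1 gT2) @* H = G2 ->
        F (gT1 * gT2)%type H].

Definition subgroup_closed (F : group_family) : Prop :=
  forall (gT : finGroupType) (G H : {group gT}), H \subset G -> F gT G -> F gT H.

Definition nilpotent_groups : group_family := fun gT G => nilpotent G.

Definition solvable_groups (pi : nat_pred) : group_family := fun gT G =>
  forall K L : {group gT}, chief_factor G K L ->
    pi^'.-group (L / K) \/ exists2 p, p \in pi & p.-group (L / K).

(* The intersection of all normal subgroups of G with quotient in F; when F
   is a formation it is the smallest of them, see residual_in and
   residual_min. *)
Definition residual (F : group_family) (gT : finGroupType) (G : {group gT})
    : {group gT} :=
  (\bigcap_(N : {group gT} | (N <| G) && `[< F _ (G / N)%G >]) N)%G.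

Definition class_prod (X F : group_family) : group_family :=
  fun gT G => X gT (residual F G).

Lemma residual_min (F : group_family) (gT : finGroupType) (G N : {group gT}) :
  N <| G -> F _ (G / N)%G -> residual F G \subset N.
Proof. by move=> nNG FN; apply: bigcap_inf; rewrite nNG; apply/asboolP. Qed.

Lemma formation_capQ (F : group_family) (gT : finGroupType)
    (G N1 N2 : {group gT}) :
    formation F -> N1 <| G -> N2 <| G ->
  F _ (G / N1)%G -> F _ (G / N2)%G -> F _ (G / (N1 :&: N2))%G.
Proof.
case=> [[_ isoF] _ subF] nN1 nN2 F1 F2.
have fM : {in G &, {morph (fun x => (coset N1 x, coset N2 x)) : x y / x * y}}.
  move=> x y Gx Gy /=; rewrite !morphM //.
  - by apply: (subsetP (normal_norm nN2)).
  - by apply: (subsetP (normal_norm nN2)).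
  - by apply: (subsetP (normal_norm nN1)).
  - by apply: (subsetP (normal_norm nN1)).
pose f := Morphism fM.
have kerf : 'ker f = N1 :&: N2.
  apply/setP=> x; rewrite !inE /=; apply/andP/andP=> [[Gx] | [N1x N2x]].
    rewrite xpair_eqE => /andP[/eqP c1 /eqP c2]; split.
      exact: coset_idr (subsetP (normal_norm nN1) x Gx) c1.
    exact: coset_idr (subsetP (normal_norm nN2) x Gx) c2.
  split; first exact: (subsetP (normal_sub nN1)).
  by rewrite xpair_eqE !coset_id ?eqxx.
apply: (isoF _ _ (f @* G)%G).
  by rewrite /= -kerf isog_sym first_isog.
apply: (subF _ _ _ _ (f @* G)%G F1 F2).
  apply/setP=> y; apply/morphimP/morphimP=> [[_ _ /morphimP[x _ Gx ->] ->] | [x Nx Gx ->]].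
    by exists x => //; apply: (subsetP (normal_norm nN1)).
  by exists (f x); rewrite ?inE ?mem_morphim.
apply/setP=> y; apply/morphimP/morphimP=> [[_ _ /morphimP[x _ Gx ->] ->] | [x Nx Gx ->]].
  by exists x => //; apply: (subsetP (normal_norm nN2)).
by exists (f x); rewrite ?inE ?mem_morphim.
Qed.

Lemma residual_in (F : group_family) (gT : finGroupType) (G : {group gT}) :
  formation F -> residual F G <| G /\ F _ (G / residual F G)%G.
Proof.
move=> formF; have [[[rT [H FH]] isoF] homF _] := formF.
pose P (N : {group gT}) := (N <| G) && `[< F _ (G / N)%G >].
have PG : P G.
  rewrite /P normal_refl; apply/asboolP.
  apply: isoF (homF _ gT _ (triv_morph gT H) FH).
  by apply: trivial_isog; [apply: morphim_trivm | apply: trivg_quotient].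
case: (@arg_minnP _ G P (fun N : {group gT} => #|N|) PG).
move=> N /andP[nNG /asboolP FN] minN.
suff -> : residual F G = N by [].
apply/val_inj/eqP; rewrite /= eqEsubset residual_min //.
apply/bigcapsP=> N' /andP[nN'G /asboolP FN'].
have PI : P (N :&: N')%G.
  by rewrite /P /= normalI //; apply/asboolP; apply: formation_capQ.
have sIN : N :&: N' \subset N by apply: subsetIl.
have /eqP <- : N :&: N' == N :> {set gT} by rewrite eqEcard sIN minN.
exact: subsetIr.
Qed.

Definition norm_piF (pi : nat_pred) (F : group_family)
    (gT : finGroupType) (G : {group gT}) : {group gT} :=
  (\bigcap_(H : {group gT} | H \subset G) 'N_G(residual F H * 'O_pi^'(G)))%G.

Definition norm_series (pi : nat_pred) (F : group_family)
    (gT : finGroupType) (G : {group gT}) (i : nat) : {group gT} :=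
  iter i (fun N : {group gT} => (coset N @*^-1 norm_piF pi F (G / N))%G) 1%G.

Lemma norm_series_stabilizes (pi : nat_pred) (F : group_family)
    (gT : finGroupType) (G : {group gT}) :
  exists i, norm_series pi F G i == norm_series pi F G i.+1.
Proof.
set N := norm_series pi F G; case: (boolP [exists i : 'I_#|gT|.+1, N i == N i.+1]).
  by case/existsP=> i eqNi; exists i.
rewrite negb_exists => /forallP neqN.
have ltN i : i <= #|gT|.+1 -> i <= #|N i|.
  elim: i => // i IHi lti; apply: leq_ltn_trans (IHi (ltnW lti)) _.
  have sN : N i \subset N i.+1 by apply: sub_cosetpre.
  rewrite proper_card // properEneq sN andbT.
  by have := neqN (Ordinal lti).
by have := leq_trans (ltN _ (leqnn _)) (max_card _); rewrite ltnn.
Qed.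

(* The first stationary term; the series is constant from there on. *)
Definition norm_series_oo (pi : nat_pred) (F : group_family)
    (gT : finGroupType) (G : {group gT}) : {group gT} :=
  norm_series pi F G (ex_minn (norm_series_stabilizes pi F G)).

Lemma chief_acts (gT : finGroupType) (G K L : {group gT}) :
    chief_factor G K L ->
  {acts G / 'C_G(L / K | 'Q), on group L / K | 'Q %% 'C_G(L / K | 'Q)}.
Proof.
case/andP=> maxK /andP[sLG nLG].
have /andP[_ nKG] := maxgroupp maxK.
have cC : 'C_G(L / K | 'Q) \subset 'C(L / K | 'Q) by apply: subsetIr.
split.
  rewrite (astabs_mod cC) quotientS //; exact: actsQ.
by rewrite gacentC ?quotientS ?subsetT // (subset_trans cC) // subsetIl.
Qed.

(* 'Q is the conjugation action of 'N(K) on cosets of K; 'Q %% C is the action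
   it induces for the quotient by C = 'C_G(L / K | 'Q), and <[ chief_acts _ ]>
   its restriction to G / C acting on L / K. *)
Definition central_factor (M : group_family) (gT : finGroupType)
    (G K L : {group gT}) (chKL : chief_factor G K L) : Prop :=
  M _ [set: sdprod_by <[ chief_acts chKL ]>%gact ]%G.

Definition hypercentral (pi : nat_pred) (M : group_family)
    (gT : finGroupType) (G N : {group gT}) : Prop :=
  N <| G /\
  (N :=: 1 \/
   N :!=: 1 /\
   forall (K L : {group gT}) (chKL : chief_factor G K L), L \subset N ->
     (exists p, [/\ prime p, p \in pi & p %| #|L / K|]) ->
     central_factor M chKL).

(* The factors are normal in G, so the order of this set product is
   immaterial and it is a subgroup. *)
Definition hypercenter (pi : nat_pred) (M : group_family)
    (gT : finGroupType) (G : {group gT}) : {set gT} :=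
  \prod_(N : {group gT} | `[< hypercentral pi M G N >]) N.

(* Main.v *)
Require Import Defs.
From mathcomp Require Import all_boot all_fingroup all_solvable.
From mathcomp Require Import boolp.

Set Implicit Arguments.
Unset Strict Implicit.
Unset Printing Implicit Defensive.

Import GroupScope.

(* For hereditary F, a chief factor L / K is (N o F)-central exactly when the
   residual R of G centralises it.  The heart of the matter is then that a
   minimal normal subgroup L of G contained in the norm is a pi'-group or is
   centralised by R.  If L is a p-group with p in pi and R does not centralise
   it, then RC / C has a nontrivial normal p'-subgroup T / C, where C = C_G(L),
   and there are a supplement H of C in G and a normal p'-subgroup K of H with
   CK = T.  Since C_L(K) = 1, L meets H O_pi'(G) trivially; as L normalises
   H^F O_pi'(G), it centralises H^F, hence also R, which lies in H^F C. *)

(** * Residuals under homomorphisms and in subgroups *)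

Lemma formation_isog (F : group_family) (gT rT : finGroupType)
    (G : {group gT}) (H : {group rT}) :
  formation F -> G \isog H -> F gT G -> F rT H.
Proof. by case=> [[_ isoF] _ _]; apply: isoF. Qed.

Lemma formation_homg (F : group_family) (gT rT : finGroupType)
    (G : {group gT}) (H : {group rT}) :
  formation F -> H \homg G -> F gT G -> F rT H.
Proof.
move=> formF /homgP[f fG] FG; have [_ homF _] := formF.
by apply: formation_isog (homF _ _ _ f FG) => //; rewrite /= fG isog_refl.
Qed.

Lemma residualP (F : group_family) (gT : finGroupType) (G N : {group gT}) :
  formation F -> N <| G -> F _ (G / N)%G <-> residual F G \subset N.
Proof.
move=> formF nsNG; split=> [|sRN]; first exact: residual_min.
have [nsRG FR] := residual_in G formF.
by apply: formation_homg FR => //; apply: homg_quotientS; rewrite ?normal_norm.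
Qed.

Lemma residual_normal (F : group_family) (gT : finGroupType) (G : {group gT}) :
  formation F -> residual F G <| G.
Proof. by move=> formF; have [] := residual_in G formF. Qed.

Lemma isog_quotient_morphim (aT rT : finGroupType) (D G : {group aT})
    (f : {morphism D >-> rT}) (N : {group rT}) :
  G \subset D -> N <| f @* G -> G / (G :&: f @*^-1 N) \isog f @* G / N.
Proof.
move=> sGD /andP[_ nNG]; pose g := [morphism of coset N \o f].
have sGg : G \subset f @*^-1 'N(N) by rewrite -sub_morphim_pre.
have := first_isog_loc g sGg; rewrite -[g @* G]/(_ @* G) morphim_comp.
by rewrite ker_comp ker_coset.
Qed.

(** A normal subgroup [N] of [f @* G] and its preimage [G :&: f @*^-1 N] have isomorphic quotients,
    so [residualP] transfers each inclusion across [f]. *)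
Lemma morphim_residual (F : group_family) (aT rT : finGroupType)
    (D G : {group aT}) (f : {morphism D >-> rT}) :
  formation F -> G \subset D -> f @* residual F G = residual F (f @* G)%G.
Proof.
move=> formF sGD; have nsRG := residual_normal G formF.
have pre_normal (N : {group rT}) : N <| f @* G -> G :&: f @*^-1 N <| G.
  move=> nsN; rewrite /normal subsetIl normsI ?normG //.
  apply: subset_trans (morphpre_norm _ _).
  by rewrite -sub_morphim_pre ?normal_norm.
apply/eqP; rewrite eqEsubset; apply/andP; split.
  rewrite sub_morphim_pre; last exact: subset_trans (normal_sub nsRG) sGD.
  have [nsR FR] := residual_in (f @* G)%G formF.
  have : residual F G \subset G :&: f @*^-1 residual F (f @* G).
    apply/(@residualP _ _ _ [group of G :&: f @*^-1 residual F (f @* G)]) => //.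
      exact: pre_normal.
    apply: formation_isog FR => //.
    by rewrite isog_sym; apply: isog_quotient_morphim.
  by rewrite subsetI => /andP[].
have nsfR : f @* residual F G <| f @* G by apply: morphim_normal.
apply/residualP => //; apply: formation_isog (isog_quotient_morphim sGD nsfR) _ => //.
apply/(@residualP _ _ _ [group of G :&: f @*^-1 (f @* residual F G)]) => //.
  exact: pre_normal.
rewrite subsetI normal_sub //= -sub_morphim_pre //.
exact: subset_trans (normal_sub nsRG) sGD.
Qed.

Lemma quotient_residual (F : group_family) (gT : finGroupType)
    (G N : {group gT}) :
  formation F -> G \subset 'N(N) -> residual F (G / N)%G = residual F G / N :> {set _}.
Proof. by move=> formF nNG; rewrite [RHS](morphim_residual _ formF nNG). Qed.

(** The quotient of [H] by its intersection with [residual F G] embeds in a quotient of [G] that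
    lies in [F]. *)
Lemma residualS (F : group_family) (gT : finGroupType) (G H : {group gT}) :
    formation F -> subgroup_closed F -> H \subset G ->
  residual F H \subset residual F G.
Proof.
move=> formF subF sHG; have [/andP[_ nRG] FG] := residual_in G formF.
have nRH := subset_trans sHG nRG.
have: residual F H \subset H :&: residual F G.
  apply/(@residualP _ _ _ [group of H :&: residual F G]) => //.
    exact: norm_normalI.
  have FH : F _ (H / residual F G)%G by apply: subF FG; apply: quotientS.
  apply: formation_isog FH => //=.
  by rewrite isog_sym setIC; apply: second_isog.
by rewrite subsetI => /andP[].
Qed.

(** * The norm and its ascending series *)

(** Every subgroup [H] of the image is the image of [H0], and the residual of [H] is the image of
    that of [H0]. *)
Lemma morphim_norm_piF (pi : nat_pred) (F : group_family)
    (aT rT : finGroupType) (D G : {group aT}) (f : {morphism D >-> rT}) :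
  formation F -> G \subset D ->
  f @* norm_piF pi F G \subset norm_piF pi F (f @* G)%G.
Proof.
move=> formF sGD; apply/bigcapsP=> H sHG.
set H0 := (G :&: f @*^-1 H)%G.
have sH0D : H0 \subset D by rewrite subIset ?sGD.
have fH0 : (f @* H0)%G = H.
  apply/val_inj; rewrite /= morphim_setIpre //; exact/setIidPr.
have sO : f @* 'O_pi^'(G) \subset 'O_pi^'(f @* G).
  by apply: pcore_max; rewrite ?morphim_pgroup ?morphim_normal ?pcore_pgroup
    ?pcore_normal.
(* The image of ['O_pi^'(G)] may be smaller than the core of the image, so the larger core, which is
   normal in [f @* G], is kept as an extra factor. *)
have -> : residual F H * 'O_pi^'(f @* G)
    = f @* (residual F H0 * 'O_pi^'(G)) * 'O_pi^'(f @* G).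
  rewrite morphimMl ?(subset_trans (normal_sub (residual_normal _ formF))) //.
  by rewrite morphim_residual // fH0 -mulgA (mulSGid sO).
have sN : norm_piF pi F G \subset 'N_G(residual F H0 * 'O_pi^'(G)).
  by apply: bigcap_inf; apply: subsetIl.
apply: subset_trans (morphimS f sN) _.
apply: subset_trans (morphim_subnorm f G _) _.
rewrite subsetI subsetIl normsM ?subsetIr //.
by apply: subset_trans (subsetIl _ _) _; apply: gFnorm.
Qed.

(** Conjugation by an element of [G] is a homomorphism from [G] onto [G], so the preceding lemma
    applies to it. *)
Lemma norm_piF_normal (pi : nat_pred) (F : group_family)
    (gT : finGroupType) (G : {group gT}) :
  formation F -> norm_piF pi F G <| G.
Proof.
move=> formF; have sNG : norm_piF pi F G \subset G.
  by apply: subset_trans (bigcap_inf G (subxx _)) (subsetIl _ _).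
apply/andP; split=> //; apply/normsP=> x Gx; apply/eqP.
rewrite eqEcard cardJg leqnn andbT.
have -> : norm_piF pi F G :^ x = conjgm G x @* norm_piF pi F G.
  by rewrite morphim_conj (setIidPr sNG).
apply: subset_trans (morphim_norm_piF pi (conjgm G x) formF (subxx G)) _.
have -> // : (conjgm G x @* G = G)%G.
by apply/val_inj; rewrite /= morphim_conj setIid conjGid.
Qed.

(** In the first case [N] lies in ['O_pi^'(G)], hence in each product to be normalised; in the
    second it centralises every [residual F H], by [residualS]. *)
Lemma sub_norm_piF (pi : nat_pred) (F : group_family)
    (gT : finGroupType) (G N : {group gT}) :
    formation F -> subgroup_closed F -> N <| G ->
    pi^'.-group N \/ N \subset 'C(residual F G) ->
  N \subset norm_piF pi F G.
Proof.
move=> formF subF nsNG; have [sNG nNG] := andP nsNG.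
case=> [piN | cNR]; apply/bigcapsP=> H sHG; rewrite subsetI sNG /=.
  have sNO : N \subset 'O_pi^'(G) by apply: pcore_max.
  have nOR : residual F H \subset 'N('O_pi^'(G)).
    apply: subset_trans (normal_norm (pcore_normal _ _)).
    exact: subset_trans (normal_sub (residual_normal H formF)) sHG.
  rewrite -norm_joinEl //; apply: subset_trans (normG _).
  exact: subset_trans sNO (joing_subr _ _).
apply: normsM; last exact: subset_trans sNG (gFnorm _ _).
by apply: cents_norm; apply: subset_trans cNR _; apply/centS/residualS.
Qed.

Lemma norm_series_normal (pi : nat_pred) (F : group_family)
    (gT : finGroupType) (G : {group gT}) i :
  formation F -> norm_series pi F G i <| G.
Proof.
move=> formF; elim: i => [|i IHi]; first exact: normal1.
rewrite -[X in _ <| X](quotientGK IHi) cosetpre_normal.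
exact: norm_piF_normal.
Qed.

(** * Images of $\pi$-solvable groups, and a supplement lemma *)

(** A chief factor of the image pulls back to a chief factor of [G] of the same order, and both
    alternatives depend on the order only. *)
Lemma morphim_solvable_groups (pi : nat_pred) (aT rT : finGroupType)
    (G D : {group aT}) (f : {morphism D >-> rT}) :
  G \subset D -> solvable_groups pi G -> solvable_groups pi (f @* G)%G.
Proof.
move=> sGD solG K L /andP[maxKL /andP[sLG nLG]].
case/maxgroupP: (maxKL) => [/andP[prKL nKG] maxK].
set K1 := (G :&: f @*^-1 K)%G; set L1 := (G :&: f @*^-1 L)%G.
have sKL := proper_sub prKL.
have pre_norm (N : {group rT}) : f @* G \subset 'N(N) -> G \subset 'N(f @*^-1 N).
  move=> nNG; apply: subset_trans (morphpre_norm _ _).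
  by rewrite -sub_morphim_pre.
have fL1 : f @* L1 = L by rewrite /= morphim_setIpre; apply/setIidPr.
have fK1 : f @* K1 = K.
  by rewrite /= morphim_setIpre; apply/setIidPr/(subset_trans sKL).
have sL1D : L1 \subset D by rewrite subIset ?sGD.
have sK1L1 : K1 \subset L1 by rewrite setIS ?morphpreS.
have chief1 : chief_factor G K1 L1.
  apply/andP; split; last by rewrite /normal subsetIl normsI ?normG ?pre_norm.
  apply/maxgroupP; split.
    rewrite normsI ?normG ?pre_norm // andbT properE sK1L1 /=.
    apply: contra (proper_subn prKL) => sL1K1.
    by rewrite -fL1 -fK1 morphimS.
  move=> M /andP[/andP[sML1 nsL1M] nMG] sK1M.
  have fM : f @* M = K.
    apply: (maxK (f @* M)%G) => /=; last by rewrite -fK1 morphimS.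
    rewrite morphim_norms // andbT properE -{1}fL1 morphimS //=.
    (* Since [M] contains [K1], it contains the kernel of [f] on [G]; so [L] inside [f @* M] would
       force [L1] inside [M]. *)
    apply: contra nsL1M => sLM; apply/subsetP=> x /setIP[Gx /morphpreP[Dx Lx]].
    have /morphimP[y Dy My fxy] := subsetP sLM _ Lx.
    have [k kerk def_x] := ker_rcoset Dx Dy fxy.
    have Gy := subsetP (subset_trans sML1 (subsetIl _ _)) y My.
    rewrite def_x groupM // (subsetP sK1M) // inE -(groupMr k Gy) -def_x Gx.
    by rewrite (subsetP (ker_sub_pre _ _)).
  apply/eqP; rewrite eqEsubset sK1M andbT subsetI.
  rewrite (subset_trans sML1) ?subsetIl //= -fM -sub_morphim_pre //.
  exact: subset_trans sML1 sL1D.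
have oLK : #|L / K| = #|L1 / K1|.
  rewrite -[in LHS]fL1 -(card_isog (isog_quotient_morphim _ _)) //; last first.
    rewrite fL1 /normal sKL; apply: subset_trans nKG.
    by rewrite -fL1; apply/morphimS/subsetIl.
  congr #|_ / _|; rewrite -setIA -morphpreI; congr (_ :&: _ @*^-1 _).
  exact/setIidPr.
by rewrite /pgroup oLK; apply: solG chief1.
Qed.

(* A supplement H minimal under inclusion works: for a Sylow p-subgroup P of
   C :&: H, then for a complement K of P in T :&: H, the Frattini argument shows
   that the normaliser in H still supplements C, hence is H. *)
Lemma normal_p'_supplement (gT : finGroupType) (p : nat) (G C T : {group gT}) :
    C <| G -> T <| G -> C \subset T -> p^'.-group (T / C) ->
  exists H K : {group gT},
    [/\ C * H = G, K <| H, p^'.-group K & C * K = T].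
Proof.
move=> /andP[sCG nCG] /andP[sTG nTG] sCT p'T.
pose supp (H : {group gT}) := (H \subset G) && (C * H == G).
have [H /mingroupP[/andP[sHG /eqP defG] minH]] : {H : {group gT} | [min H | supp H]}.
  by apply: ex_mingroup; exists G; rewrite /supp subxx mulSGid /=.
have {}minH (X : {group gT}) : X \subset H -> H \subset C * X -> X :=: H.
  move=> sXH sHCX; apply: minH => //; rewrite /supp (subset_trans sXH) //=.
  rewrite eqEsubset mul_subG ?(subset_trans sXH) //=.
  by rewrite -{1}defG -[in X in _ \subset X](mulGid C) -mulgA mulgS.
have nCH := subset_trans sHG nCG; have nTH := subset_trans sHG nTG.
have nsIH : C :&: H <| H by rewrite /normal subsetIr normsI ?normG.
have [P sylP] := Sylow_exists p (C :&: H).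
have [sPI pP _] := and3P sylP; have [sPC sPH] := subsetIP sPI.
have nPH : H \subset 'N(P).
  have /setIidPl // : H :&: 'N(P) = H.
  apply: (minH [group of 'N_H(P)]); first exact: subsetIl.
  by rewrite -{1}(Frattini_arg nsIH sylP) mulSg ?subsetIl.
have nsTH : T :&: H <| H by rewrite /normal subsetIr normsI ?normG.
have sPTH : P \subset T :&: H by rewrite subsetI (subset_trans sPC).
have sylTH : p.-Sylow(T :&: H) P.
  have [Q sylQ sPQ] := Sylow_superset sPTH pP.
  have [/subsetIP[sQT sQH] pQ _] := and3P sylQ.
  (* The image of [Q] in [T / C] is both a $p$-group and a $p'$-group. *)
  have sQC : Q \subset C.
    rewrite -quotient_sub1 ?(subset_trans sQH) //.
    have p'Q : p^'.-group (Q / C) by apply: pgroupS p'T; apply: quotientS.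
    have := pnat_1 (quotient_pgroup C pQ) p'Q.
    by move/card1_trivg->.
  by rewrite -(sub_pHall sylP pQ) // subsetI sQC.
have nsPTH : P <| T :&: H.
  by rewrite /normal sPTH (subset_trans _ nPH) ?subsetIr.
have hallP := pHall_Hall sylTH.
have /splitsP[K /complP[tiPK defTH]] := SchurZassenhaus_split hallP nsPTH.
have [_ _] := and3P sylTH; rewrite -divgS // -defTH (TI_cardMg tiPK) mulKn // => p'K.
have sKH : K \subset H.
  by apply: subset_trans (subsetIr T H); rewrite -defTH mulG_subr.
exists H, K; split=> //; last first.
  rewrite -[in LHS](mulGSid sPC) -mulgA defTH /= setIC group_modl // defG.
  exact/setIidPr.
rewrite /normal sKH /=.
have /setIidPl // : H :&: 'N(K) = H.
apply: (minH [group of 'N_H(K)]); first exact: subsetIl.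
apply/subsetP=> h Hh.
(* Both [K] and [K :^ h] complement [P] in [T :&: H], so they are conjugate under [P], which lies in
   [C]; then [h * x^-1] normalises [K]. *)
have [x Px defKh] : exists2 x, x \in P & K :^ h = K :^ x.
  apply: SchurZassenhaus_trans_sol.
  - exact: nilpotent_sol (pgroup_nil pP).
  - exact: subset_trans sKH nPH.
  - rewrite defTH /= -(normsP (normal_norm nsTH) h Hh) conjSg.
    by have := mulG_subr P K; rewrite defTH.
  - exact: pnat_coprime pP p'K.
  - exact: cardJg.
rewrite -normC; last by rewrite (subset_trans _ nCH) ?subsetIl.
rewrite -(mulgKV x h) mem_mulg ?(subsetP sPC) // inE groupM ?groupV ?Hh ?(subsetP sPH x) //=.
by apply/normP; rewrite conjsgM defKh -conjsgM mulgV conjsg1.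
Qed.

(** * Minimal normal subgroups contained in the norm *)

Lemma minnormal_id (gT : finGroupType) (G L N : {group gT}) :
  minnormal L G -> N \subset L -> G \subset 'N(N) -> N :!=: 1 -> N :=: L.
Proof. by case/mingroupP=> _ minL sNL nNG ntN; apply: minL; rewrite ?ntN. Qed.

Lemma solvable_groups_minnormal (pi : nat_pred) (gT : finGroupType)
    (G L : {group gT}) :
    solvable_groups pi G -> minnormal L G -> L \subset G ->
  pi^'.-group L \/ exists2 p, p \in pi & p.-group L.
Proof.
move=> solG minL sLG; have [/andP[ntL nLG] _] := mingroupP minL.
have chL : chief_factor G (1%G : {group gT}) L.
  apply/andP; split; last exact/andP.
  apply/maxgroupP; split=> [|N /andP[prNL nNG] _]; first by rewrite proper1G ntL norms1.
  apply/eqP; apply: contraTT (prNL) => ntN.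
  by rewrite (minnormal_id minL (proper_sub prNL) nNG ntN) properxx.
have:= solG _ _ chL; by rewrite /pgroup /= -(card_isog (quotient1_isog L)).
Qed.

(** The preimage [P] of the core is [C * S] with [S] a Sylow $p$-subgroup of [P]. As [L <*> S] is a
    $p$-group, its centre meets [L] nontrivially, so ['C_L(P)] is nontrivial; being normalised by
    [G], it is [L], and [P] lies in [C]. *)
Lemma pcore_quotient_cent (gT : finGroupType) (p : nat) (G L : {group gT}) :
  minnormal L G -> L \subset G -> p.-group L -> 'O_p(G / 'C_G(L)) = 1.
Proof.
move=> minL sLG pL; have [/andP[ntL nLG] _] := mingroupP minL.
set C := ('C_G(L))%G.
have nsCG : C <| G by rewrite norm_normalI // norms_cent.
have [sCG nCG] := andP nsCG.
set P := (coset C @*^-1 'O_p(G / C))%G.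
have nsPG : P <| G by rewrite -(quotientGK nsCG) cosetpre_normal pcore_normal.
have [sPG nPG] := andP nsPG.
have defP : P / C = 'O_p(G / C) by rewrite cosetpreK.
have [S sylS] := Sylow_exists p P; have [sSP pS _] := and3P sylS.
have nCS : S \subset 'N(C) by rewrite (subset_trans sSP) ?(subset_trans sPG).
have sPCS : P \subset C * S.
  rewrite -quotientSK ?(subset_trans sPG) //.
  rewrite (pHall_id (quotient_pHall _ sylS)) //.
  by rewrite /= defP pcore_pgroup.
have nLS : S \subset 'N(L) by rewrite (subset_trans sSP) ?(subset_trans sPG).
have pLS : p.-group (L <*> S) by rewrite norm_joinEr // pgroupM pL.
have ntLZ : L :&: 'Z(L <*> S) != 1.
  by rewrite meet_center_nil ?(pgroup_nil pLS) // normalYl.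
have sLZ : L :&: 'Z(L <*> S) \subset 'C_L(P).
  rewrite subsetI subsetIl centsC (subset_trans sPCS) // mul_subG //.
    by rewrite subIset // orbC centS ?subsetIl.
  rewrite centsC; apply: subset_trans (subsetIr _ _) _.
  by apply: subset_trans (subsetIr _ _) _; rewrite centS ?joing_subr.
have defL : 'C_L(P) = L.
  apply: (minnormal_id minL); rewrite ?subsetIl //.
    by rewrite normsI // norms_cent.
  by apply: contraNneq ntLZ => L1; rewrite -subG1 -L1.
apply/trivgP; rewrite /= -defP quotient_sub1; last exact: subset_trans sPG nCG.
by rewrite subsetI sPG centsC -{1}defL subsetIr.
Qed.

Lemma minnormal_norm_piF (pi : nat_pred) (F : group_family)
    (gT : finGroupType) (G L : {group gT}) :
    formation F -> subgroup_closed F ->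
    solvable_groups pi (residual F G) ->
    minnormal L G -> L \subset norm_piF pi F G ->
  pi^'.-group L \/ L \subset 'C(residual F G).
Proof.
move=> formF subF; set R := residual F G => solR minL sLN.
have nsNG := norm_piF_normal pi G formF.
have sLG := subset_trans sLN (normal_sub nsNG).
have [/andP[ntL nLG] _] := mingroupP minL.
have nsLG : L <| G by apply/andP.
have nsRG : R <| G := residual_normal G formF; have [sRG nRG] := andP nsRG.
have [ti_LR | ntLR] := eqVneq (L :&: R) 1.
  right; rewrite (sameP commG1P trivgP) -ti_LR commg_subI // subsetI subxx.
    exact: subset_trans sLG nRG.
  exact: subset_trans sRG nLG.
have sLR : L \subset R.
  apply/setIidPl; apply: (minnormal_id minL); rewrite ?subsetIl //.
  by rewrite normsI.
(* Only [R] is known to be $\pi$-solvable, and [L] need not be minimal normal in [R]. The type of a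
   minimal normal subgroup [M] of [R] inside [L] passes to [L] through the characteristic subgroup
   ['O_rho(L)]. *)
have [M minM sML] := minnormal_exists ntL (subset_trans sRG nLG).
have [/andP[ntM nMR] _] := mingroupP minM.
have core_id (rho : nat_pred) : rho.-group M -> rho.-group L.
  move=> rhoM; have sMO : M \subset 'O_rho(L).
    by apply: pcore_max; rewrite // /normal sML (subset_trans sLR).
  suff <- : 'O_rho(L) = L by apply: pcore_pgroup.
  apply: (minnormal_id minL); rewrite ?pcore_sub ?gFnorm_trans //.
  by apply: contraNneq ntM => O1; rewrite -subG1 -O1.
have sMR := subset_trans sML sLR.
have [/core_id|] := solvable_groups_minnormal solR minM sMR; first by left.
case=> p pi_p /core_id pL.
set C := ('C_G(L))%G.
have nsCG : C <| G by rewrite norm_normalI // norms_cent.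
have [sCG nCG] := andP nsCG.
have [sRC | not_sRC] := boolP (R \subset C).
  by right; rewrite centsC (subset_trans sRC) ?subsetIr.
case/negP: not_sRC.
have Op1 := pcore_quotient_cent minL sLG pL.
have nCR := subset_trans sRG nCG; have nCL := subset_trans sLG nCG.
rewrite -quotient_sub1 //; apply: contraT; rewrite subG1 => ntRC.
have [Q minQ sQR] := minnormal_exists ntRC (normG _).
have [/andP[ntQ nQR] _] := mingroupP minQ.
(* A $p$-group [Q] would lie in ['O_p(G / C)], which is trivial; the other alternatives are
   $p'$-groups because [p] is in [pi]. *)
have p'Q : p^'.-group Q.
  have solRC : solvable_groups pi (R / C)%G := morphim_solvable_groups nCR solR.
  have [piQ | [q pi_q qQ]] := solvable_groups_minnormal solRC minQ sQR.
    by apply: sub_pgroup piQ => r; apply: contraNN => /eqnP->.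
  have [eq_qp | neq_qp] := eqVneq q p; last first.
    by apply: sub_pgroup qQ => r /eqnP->.
  case/negP: ntQ; rewrite -subG1 -Op1.
  have sQO : Q \subset 'O_p(R / C).
    by apply: pcore_max; rewrite -?eq_qp // /normal sQR.
  apply: subset_trans sQO _; apply: pcore_max; first exact: pcore_pgroup.
  by rewrite gFnormal_trans ?quotient_normal.
set T := (coset C @*^-1 'O_p^'(R / C))%G.
have defT : T / C = 'O_p^'(R / C) by rewrite cosetpreK.
have nsTG : T <| G.
  by rewrite -(quotientGK nsCG) cosetpre_normal gFnormal_trans ?quotient_normal.
have [sTG nTG] := andP nsTG.
have sCT : C \subset T := sub_cosetpre _.
have nsTC : ~~ (T \subset C).
  rewrite -quotient_sub1 ?(subset_trans sTG) // defT subG1.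
  apply: contraNneq ntQ => O1; rewrite -subG1 -O1.
  by apply: pcore_max; rewrite // /normal sQR.
(* This centraliser is normalised by [G]; were it [L], then [T] would lie in [C]. *)
have cLT : 'C_L(T) = 1.
  apply/eqP; apply: contraR nsTC => ntCT; rewrite subsetI sTG centsC.
  have <- : 'C_L(T) = L; last exact: subsetIr.
  by apply: (minnormal_id minL); rewrite ?subsetIl ?normsI ?norms_cent.
have p'T : p^'.-group (T / C) by rewrite /= defT pcore_pgroup.
have [H [K [defG nsKH p'K defCK]]] := normal_p'_supplement nsCG nsTG sCT p'T.
have sHG : H \subset G by rewrite -defG mulG_subr.
have [sKH nKH] := andP nsKH.
have cLK : 'C_L(K) = 1.
  apply/trivgP; rewrite -cLT subsetI subsetIl -defCK centsC mul_subG //.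
    by rewrite centsC; apply: subset_trans (subsetIl _ _) _; rewrite centsC subsetIr.
  by rewrite centsC subsetIr.
set O := ('O_pi^'(G))%G.
have tiLO : L :&: O = 1.
  apply/coprime_TIg/(pnat_coprime pL)/(sub_in_pnat _ (pcore_pgroup _ _)) => r _.
  by apply: contraNN => /eqnP->.
have [sOG nOG] : O \subset G /\ G \subset 'N(O) := andP (pcore_normal _ _).
have nOL := subset_trans sLG nOG; have defLO := norm_joinEl nOL.
(* Modulo [O] the intersection is both a $p$-group and a $p'$-group. *)
have sKLO : K :&: (L <*> O) \subset O.
  set X := (K :&: (L <*> O))%G.
  have nOX : X \subset 'N(O).
    by rewrite (subset_trans (subsetIl _ _)) // (subset_trans sKH) ?(subset_trans sHG).
  rewrite -quotient_sub1 // (card1_trivg (_ : #|X / O| = 1%N)) //.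
  apply: (@pnat_1 p).
    apply: pgroupS (quotient_pgroup O pL) => /=.
    by rewrite -[L / _]quotientMidr -defLO quotientS ?subsetIr.
  by apply: quotient_pgroup; apply: pgroupS p'K; apply: subsetIl.
have defHO := norm_joinEl (subset_trans sHG nOG).
(* Write [l = h * o] and take [k] in [K]. Modulo [O], [[~ l, k]] equals [[~ h, k]], which lies in
   [K] as [K] is normal in [H], and in [L <*> O] as [h] does; so it is in [O]. Hence [[~ l, k]] lies
   in [L :&: O = 1], and [l] is in ['C_L(K) = 1]. *)
have tiLHO : L :&: (H <*> O) = 1.
  apply/trivgP; rewrite -cLK /= defHO; apply/subsetP=> l /setIP[Ll /mulsgP[h o Hh Oo def_l]].
  rewrite inE Ll /=; apply/centP=> k Kk; apply/commgP/eqP/set1P.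
  have Hk := subsetP sKH k Kk; have Gk := subsetP sHG k Hk.
  have Gh := subsetP sHG h Hh; have Gl := subsetP sLG l Ll.
  have nOg x : x \in G -> x \in 'N(O) by apply: subsetP.
  rewrite -[[set 1]]tiLO inE; apply/andP; split.
    by rewrite commgEl groupM ?groupV // memJ_norm // (subsetP nLG).
  apply: coset_idr; first by rewrite nOg ?groupR.
  have LOh : h \in L <*> O.
    by rewrite -(mulgK o h) -def_l groupM ?groupV ?mem_gen // inE ?Ll ?Oo ?orbT.
  have nLOk : k \in 'N(L <*> O) by rewrite (subsetP _ _ Gk) // normsY.
  have coh : coset O l = coset O h by rewrite def_l coset_kerr.
  have -> : coset O [~ l, k] = coset O [~ h, k] by rewrite !morphR ?nOg //= coh.
  apply: coset_id.
  rewrite (subsetP sKLO) // inE {1}commgEr commgEl groupM //=; last first.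
    by rewrite memJ_norm ?groupV // (subsetP nKH).
  by rewrite groupM ?groupV // memJ_norm.
(* Here membership of [L] in the norm is used: the commutator of [L] with [residual F H] lies in
   [L :&: (residual F H <*> O)]. *)
have cLH : residual F H \subset C.
  have nsRH := residual_normal H formF; have sRH := normal_sub nsRH.
  rewrite subsetI (subset_trans sRH) //= centsC; apply/commG1P/trivgP.
  have nOR : residual F H \subset 'N(O).
    by apply: subset_trans sRH (subset_trans sHG nOG).
  have nLR : residual F H \subset 'N(L).
    by apply: subset_trans sRH (subset_trans sHG nLG).
  have nRO : L \subset 'N(residual F H <*> O).
    rewrite norm_joinEl //.
    by apply: subset_trans sLN (subset_trans (bigcap_inf H sHG) (subsetIr _ _)).
  rewrite -tiLHO; apply: (@subset_trans _ _ (mem (L :&: (residual F H <*> O)))).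
    rewrite (subset_trans (commgS _ (joing_subl _ O))) // commg_subI // subsetI subxx.
      by [].
    by rewrite join_subG nLR (subset_trans sOG).
  by rewrite setIS // genS // setSU.
have defH : (G / C = H / C)%G.
  by apply: group_inj; have := quotientMidl C H; rewrite defG.
have nCH := subset_trans sHG nCG.
have defRC : residual F G / C = 1.
  rewrite -(quotient_residual formF nCG) defH (quotient_residual formF nCH).
  by rewrite quotientS1.
by case/eqP: ntRC.
Qed.

(** * Central chief factors *)

Lemma chief_actE (gT : finGroupType) (G K L : {group gT})
    (chKL : chief_factor G K L) x g :
  x \in L / K -> g \in G ->
  <[chief_acts chKL]>%gact x (coset 'C_G(L / K | 'Q) g) = x ^ coset K g.
Proof.
move=> Lx Gg; have /andP[maxK /andP[sLG nLG]] := chKL.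
have /andP[_ nKG] := maxgroupp maxK.
have nKg := subsetP nKG g Gg.
rewrite /= actbyE ?mem_quotient // [LHS]modactE /=.
- by rewrite qactJ nKg.
- by rewrite dom_qactJ.
- have nCG : G \subset 'N('C_G(L / K | 'Q)).
    rewrite normsI ?normG // (subset_trans _ (astab_norm _ _)) //.
    exact: actsQ.
  exact: subsetP nCG g Gg.
- apply/afixP=> a /setIP[_ /setIP[_ cLa]]; exact: astab_act cLa Lx.
Qed.

(** If [L :&: N] is nontrivial, it meets the centre of [N], so [L :&: 'Z(N)] is all of [L] by
    minimality; otherwise [L] and [N] commute. *)
Lemma nilpotent_cent_minnormal (gT : finGroupType) (G N L : {group gT}) :
  N <| G -> nilpotent N -> minnormal L G -> L \subset G -> N \subset 'C(L).
Proof.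
move=> /andP[sNG nNG] nilN minL sLG; have [/andP[ntL nLG] _] := mingroupP minL.
have nsLN : L :&: N <| N.
  by rewrite /normal subsetIr normsI ?normG // (subset_trans sNG).
have [tiLN | ntLN] := eqVneq (L :&: N) 1.
  rewrite centsC (sameP commG1P trivgP) -tiLN commg_subI // subsetI subxx.
    exact: subset_trans sLG nNG.
  exact: subset_trans sNG nLG.
have defL : L :&: 'Z(N) = L.
  apply: (minnormal_id minL); rewrite ?subsetIl //.
    by rewrite normsI // gFnorm_trans.
  have := meet_center_nil nilN nsLN ntLN.
  by apply: contraNneq => LZ1; rewrite -subG1 -LZ1 /= -setIA setIS ?subsetIr.
by rewrite centsC -defL (subset_trans (subsetIr _ _)) ?subsetIr.
Qed.

(** The quotient [G / N] is an image of [A]. *)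
Lemma residual_sub_supplement (F : group_family) (gT : finGroupType)
    (G A N : {group gT}) :
  formation F -> F _ A -> N <| G -> N * A = G -> residual F G \subset N.
Proof.
move=> formF FA nsNG defG; have [sNG nNG] := andP nsNG.
have sAG : A \subset G by rewrite -defG mulG_subr.
apply: residual_min => //; apply: formation_homg FA => //=.
rewrite -defG quotientMidl; exact: quotient_homg (subset_trans sAG nNG).
Qed.

(* Qualified because all_solvable exports another central_factor.
   When R centralises L / K, the residual of X = (L / K) ><| (G / C) lies in
   both V = L / K and 'C_X(V), since G / C supplements each of them, so it is
   abelian even if L / K is not. *)
Lemma central_factorP (F : group_family) (gT : finGroupType)
    (G K L : {group gT}) (chKL : chief_factor G K L) :
    formation F -> subgroup_closed F ->
  Defs.central_factor (class_prod nilpotent_groups F) chKL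
    <-> residual F G / K \subset 'C(L / K).
Proof.
move=> formF subF; have /andP[maxK /andP[sLG nLG]] := chKL.
have /andP[/proper_sub sKL nKG] := maxgroupp maxK.
set R := residual F G; have nsRG : R <| G := residual_normal G formF.
have [sRG nRG] := andP nsRG.
set C := ('C_G(L / K | 'Q))%G.
have nsCG : C <| G.
  rewrite norm_normalI // (subset_trans _ (astab_norm _ _)) //; exact: actsQ.
have [sCG nCG] := andP nsCG.
have -> : (R / K \subset 'C(L / K)) = (R \subset C).
  by rewrite subsetI sRG /= astabQ sub_quotient_pre ?(subset_trans sRG nKG).
rewrite /Defs.central_factor /class_prod /nilpotent_groups.
set to := <[chief_acts chKL]>%gact.
set X := [set: sdprod_by to]%G.
set V := (sdpair1 to @* (L / K))%G; set A := (sdpair2 to @* (G / C))%G.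
have sdJ x g : x \in L / K -> g \in G ->
    sdpair1 to (x ^ coset K g) = sdpair1 to x ^ sdpair2 to (coset C g).
  by move=> Lx Gg; rewrite -(chief_actE chKL) // sdpair_act ?mem_quotient.
have [nsVX _ defX nVA _] : [/\ V <| X, A \subset X, V * A = X, A \subset 'N(V) & V :&: A = 1].
  exact: sdprod_context (sdprod_sdpair to).
have [sVX nVX] := andP nsVX.
split=> [nilR | sRC].
  have minLK := chief_factor_minnormal chKL.
  have [/andP[ntLK nLK] _] := mingroupP minLK.
  (* A subgroup of [V] normalised by [X] pulls back along [sdpair1 to] to one of [L / K] normalised
     by [G / K], since [sdJ] matches the two conjugations. *)
  have minV : minnormal V X.
    apply/mingroupP; split=> [|W /andP[ntW nWX] sWV].
      by rewrite nVX andbT morphim_injm_eq1 ?injm_sdpair1.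
    set W0 := (sdpair1 to @*^-1 W)%G.
    have defW : sdpair1 to @* W0 = W.
      exact: morphpreK (subset_trans sWV (morphimS _ _)).
    rewrite -defW; congr (_ @* _); apply: (minnormal_id minLK).
    - exact: subsetIl.
    - apply/subsetP=> _ /morphimP[g Ng Gg ->]; rewrite inE.
      apply/subsetP=> _ /imsetP[x /morphpreP[Lx Wx] ->]; apply/morphpreP; split.
        by rewrite /= memJ_norm // (subsetP nLK) ?mem_quotient.
      rewrite /= sdJ //= memJ_norm // (subsetP nWX) ?inE //.
    - apply: contraNneq ntW => W1; rewrite -defW /= W1 morphim1.
      exact: eqxx.
  have cVR := nilpotent_cent_minnormal (residual_normal X formF) nilR minV sVX.
  have sRA : sdpair2 to @* (R / C) \subset residual F X.
    rewrite -(quotient_residual formF nCG).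
    have -> := @morphim_residual F _ _ _ (G / C)%G (sdpair2_morphism to) formF (subxx _).
    by apply: residualS => //; apply: subsetT.
  apply/subsetP=> g Rg; have Gg := subsetP sRG g Rg.
  apply/setIP; split=> //; rewrite /= astabQ; apply/morphpreP; split.
    exact: subsetP nKG g Gg.
  apply/centP=> x Lx; apply/commute_sym/commgP/conjg_fixP.
  apply: (injmP (injm_sdpair1 to)) => //.
    by rewrite /= memJ_norm // (subsetP nLK) ?mem_quotient.
  rewrite /= sdJ //; apply/conjg_fixP/commgP.
  have /centP cV : sdpair2 to (coset C g) \in 'C(V).
    rewrite (subsetP cVR) // (subsetP sRA) // mem_morphim ?mem_quotient //=.
  by apply/commute_sym/cV; rewrite mem_morphim.
have FA : F _ A.
  have [_ homF _] := formF; apply: (homF _ _ _ (sdpair2_morphism to)).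
  by apply/residualP.
have sRV : residual F X \subset V.
  exact: residual_sub_supplement FA nsVX defX.
have sRCV : residual F X \subset 'C_X(V).
  apply: (residual_sub_supplement (N := 'C_X(V)%G) formF FA).
    by rewrite norm_normalI ?norms_cent.
  (* The element of [V] given by [l] in [L] and the element of [A] given by the same [l] act alike
     on [V], so they differ by an element of ['C_X(V)]. *)
  suff sVCA : V \subset 'C_X(V) * A.
    apply/eqP; rewrite eqEsubset subsetT andTb.
    by have := mulSg A sVCA; rewrite -mulgA mulGid defX.
  apply/subsetP=> _ /morphimP[y Ly _ ->].
  have /morphimP[l Nl Ll ->] := Ly.
  have Gl := subsetP sLG l Ll; have CXl : sdpair2 to (coset C l) \in A.
    by rewrite mem_morphim ?mem_quotient.
  rewrite -[X in X \in _](mulgKV (sdpair2 to (coset C l))) mem_mulg //.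
  rewrite !inE /=; apply/centP=> _ /morphimP[x Lx _ ->].
  apply/commute_sym/commgP/conjg_fixP; rewrite conjgM.
  have -> : sdpair1_morphism to x ^ sdpair1 to (coset K l) = sdpair1 to (x ^ coset K l).
    by rewrite /= [RHS](morphJ (sdpair1_morphism to)) ?mem_quotient.
  by rewrite sdJ // conjgK.
apply: abelian_nil; apply: subset_trans sRCV _.
by rewrite (subset_trans (subsetIr _ _)) ?centS.
Qed.

(** * Chief factors and the norm series *)

(** The natural map from [G / N] onto [G / M] carries norm into norm, by [morphim_norm_piF]. *)
Lemma norm_piF_quotientS (pi : nat_pred) (F : group_family)
    (gT : finGroupType) (G M N : {group gT}) :
    formation F -> N <| G -> M <| G -> N \subset M ->
  coset N @*^-1 norm_piF pi F (G / N) / M \subset norm_piF pi F (G / M).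
Proof.
move=> formF nsNG /andP[sMG nMG] sNM; have [sNG nNG] := andP nsNG.
have sker : 'ker (coset N) \subset 'ker (restrm nMG (coset M)).
  by rewrite ker_restrm !ker_coset subsetI sNG.
pose f := factm_morphism sker nNG.
have fQ (X : {group gT}) : X \subset G -> f @* (X / N) = X / M.
  by move=> sXG; rewrite [LHS]morphim_factm morphim_restrm (setIidPr sXG).
set D := (coset N @*^-1 norm_piF pi F (G / N))%G.
have sDG : D \subset G.
  by rewrite sub_cosetpre_quo ?normal_sub ?norm_piF_normal.
have <- : (f @* (G / N) = G / M)%G by apply: group_inj; apply: fQ.
by rewrite -(fQ D) // cosetpreK morphim_norm_piF.
Qed.

(** At the first term [D1] whose intersection with [L] leaves [K], let [D] be the term before and
    [M = K <*> D]. Then [M :&: L = K], and [L / M] is a minimal normal subgroup of [G / M] inside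
    its norm, so [minnormal_norm_piF] applies and the outcome pulls back to [L / K]. *)
Lemma chief_norm_series (pi : nat_pred) (F : group_family)
    (gT : finGroupType) (G K L : {group gT}) n :
    formation F -> subgroup_closed F ->
    solvable_groups pi (residual F G) -> chief_factor G K L ->
    ~~ (L :&: norm_series pi F G n \subset K) ->
  pi^'.-group (L / K) \/ residual F G / K \subset 'C(L / K).
Proof.
move=> formF subF solR /andP[maxKL /andP[sLG nLG]].
have /maxgroupP[/andP[prKL nKG] maxK] := maxKL.
have sKL := proper_sub prKL; have sKG := subset_trans sKL sLG.
elim: n => [|n IHn] nsLDK; first by rewrite (subset_trans (subsetIr _ _)) ?sub1G in nsLDK.
have [sLDK | /IHn //] := boolP (L :&: norm_series pi F G n \subset K).
set D := norm_series pi F G n in sLDK; set D1 := norm_series pi F G n.+1 in nsLDK.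
have nsDG : D <| G by apply: norm_series_normal.
have /andP[_ nD1G] : D1 <| G by apply: norm_series_normal.
have maxK_eq (X : {group gT}) : K \subset X -> X \subset L -> G \subset 'N(X) ->
    X :=: K \/ X :=: L.
  move=> sKX sXL nXG; have [] := eqVproper sXL; first by right.
  by move=> prXL; left; apply: maxK; rewrite ?prXL.
set M := (K <*> D)%G.
have nsMG : M <| G by rewrite normalY // /normal sKG.
have [sMG nMG] := andP nsMG; have sKM : K \subset M := joing_subl _ _.
have defK : M :&: L = K.
  rewrite /= norm_joinEr ?(subset_trans (normal_sub nsDG)) // -group_modl //.
  by apply: mulGSid; rewrite /= setIC.
have defL : K <*> (L :&: D1) = L.
  have [||| eqK | //] := maxK_eq (K <*> (L :&: D1))%G.
  - exact: joing_subl.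
  - by rewrite join_subG sKL subsetIl.
  - exact: normsY nKG (normsI nLG nD1G).
  by case/negP: nsLDK; rewrite -eqK joing_subr.
have nML := subset_trans sLG nMG.
have sLM : ~~ (L \subset M).
  by apply/negP=> /setIidPr eqL; rewrite -{1}defK eqL properxx in prKL.
have minL : minnormal (L / M) (G / M).
  apply/mingroupP; split=> [|Y /andP[ntY nYG] sYL].
    by rewrite -subG1 quotient_sub1 // sLM quotient_norms.
  have defY : (L :&: coset M @*^-1 Y) / M = Y.
    by rewrite quotient_setIpre; apply/setIidPr.
  have [||| eqK | eqL] := maxK_eq (L :&: coset M @*^-1 Y)%G.
  - by rewrite subsetI sKL (subset_trans sKM) ?sub_cosetpre.
  - exact: subsetIl.
  - rewrite normsI // -(quotientGK nsMG) (subset_trans _ (morphpre_norm _ _)) //.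
    by rewrite morphpreS.
  - by case/eqP: ntY; rewrite -defY eqK quotientS1.
  - by rewrite -defY eqL.
have defRM : residual F (G / M)%G = (residual F G / M)%G.
  by apply: group_inj; apply: quotient_residual.
have nRG := normal_norm (residual_normal G formF).
have sRG := normal_sub (residual_normal G formF).
have solRM : solvable_groups pi (residual F (G / M)%G).
  by rewrite defRM; apply: morphim_solvable_groups; rewrite // (subset_trans sRG).
(* Modulo [M], which contains [K], the group [L = K <*> (L :&: D1)] is covered by [D1], and [D1 / D]
   is the norm of [G / D]. *)
have sLN : L / M \subset norm_piF pi F (G / M)%G.
  apply: subset_trans (norm_piF_quotientS pi formF nsDG nsMG (joing_subr _ _)).
  rewrite quotientSK // -defL norm_joinEr; last first.
    by rewrite (subset_trans (subsetIl _ _)) ?(subset_trans sLG).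
  by rewrite mulgSS ?subsetIr.
have [piL | cLR] := minnormal_norm_piF formF subF solRM minL sLN; [left | right].
  by rewrite /pgroup -defK (card_isog (second_isog nML)).
have nKR := subset_trans sRG nKG.
rewrite quotient_cents2 ?(subset_trans sLG) // -defK subsetI.
rewrite defRM centsC quotient_cents2 ?(subset_trans sRG) // in cLR.
by rewrite cLR commg_subr (subset_trans sRG).
Qed.

(** A normal subgroup [X] of [G] minimal among those inside [N] but not inside [E] gives a chief
    factor [X / (E :&: X)]. By [sub_norm_piF] its copy [X / E] lies in the norm of [G / E], which is
    trivial. *)
Lemma sub_norm_piF_fixpoint (pi : nat_pred) (F : group_family)
    (gT : finGroupType) (G N E : {group gT}) :
    formation F -> subgroup_closed F -> N <| G -> E <| G ->
    (forall K L : {group gT}, chief_factor G K L -> L \subset N ->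
       pi^'.-group (L / K) \/ residual F G / K \subset 'C(L / K)) ->
    coset E @*^-1 norm_piF pi F (G / E) \subset E ->
  N \subset E.
Proof.
move=> formF subF nsNG nsEG chN sE1E; apply: contraT => nsNE.
pose P (X : {group gT}) := [&& X <| G, X \subset N & ~~ (X \subset E)].
have [X /mingroupP[/and3P[nsXG sXN nsXE] minX]] : {X : {group gT} | [min X | P X]}.
  by apply: ex_mingroup; exists N; rewrite /P nsNG subxx nsNE.
have [[sXG nXG] [sEG nEG]] := (andP nsXG, andP nsEG).
have chX : chief_factor G (E :&: X) X.
  apply/andP; split=> //; apply/maxgroupP; split.
    by rewrite properE subsetIr subsetI subxx andbT nsXE normsI.
  move=> Y /andP[prYX nYG] sXEY; have sYX := proper_sub prYX.
  apply/eqP; rewrite eqEsubset sXEY andbT subsetI sYX andbT.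
  apply: contraTT (prYX) => nsYE; rewrite (minX Y) ?properxx // /P nsYE.
  by rewrite /normal (subset_trans sYX) // nYG (subset_trans sYX).
case/negP: nsXE; apply: subset_trans sE1E; have nEX := subset_trans sXG nEG.
rewrite -sub_quotient_pre //; apply: sub_norm_piF => //.
  exact: quotient_normal.
have [piX | cXR] := chN (E :&: X)%G X chX sXN; [left | right].
  by rewrite /pgroup -(card_isog (second_isog nEX)).
have sRG := normal_sub (residual_normal G formF).
rewrite (quotient_residual formF nEG) quotient_cents2 ?(subset_trans sRG) //.
have nIG : G \subset 'N(E :&: X) by rewrite normsI.
rewrite centsC quotient_cents2 ?(subset_trans sXG) // 1?(subset_trans sRG) // in cXR.
exact: subset_trans cXR (subsetIl _ _).
Qed.

(** * The stationary term as the largest hypercentral subgroup *)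

(** Every factor contains 1, so the product contains the factor [E], whatever the order of
    multiplication. *)
Lemma prod_max_group (gT : finGroupType) (P : pred {group gT}) (E : {group gT}) :
  P E -> (forall N : {group gT}, P N -> N \subset E) ->
  \prod_(N : {group gT} | P N) N = E :> {set gT}.
Proof.
move=> PE maxE; apply/eqP; rewrite eqEsubset; apply/andP; split.
  apply: (big_ind (fun A : {set gT} => A \subset E)) => //; first exact: sub1G.
  by move=> A B sAE sBE; apply: mul_subG.
have: E \in index_enum {group gT} by rewrite mem_index_enum.
elim: (index_enum _) => // N s IHs; rewrite inE big_cons.
have one_prod : 1 \in \prod_(M <- s | P M) M.
  by apply: (big_ind (fun A : {set gT} => 1 \in A)) => // A B A1 B1; rewrite -[1]mulg1 mem_mulg.
case/predU1P=> [<- | /IHs sE]; first by rewrite PE mulg_subl.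
case: ifP => // PN; exact: subset_trans sE (mulg_subr _ (group1 N)).
Qed.

Theorem theoremD (pi : nat_pred) (F : group_family)
    (pi_primes : forall p : nat, p \in pi -> prime p)
    (formF : formation F) (subF : subgroup_closed F)
    (gT : finGroupType) (G : {group gT})
    (GSF : class_prod (solvable_groups pi) F G) :
  norm_series_oo pi F G = hypercenter pi (class_prod nilpotent_groups F) G :> {set gT}.
Proof.
rewrite /norm_series_oo; case: ex_minnP => n /eqP stabE _.
have nsEG := norm_series_normal pi G n formF.
(* It remains to see that the stationary term is hypercentral, by [chief_norm_series], and contains
   every hypercentral [N], by [sub_norm_piF_fixpoint]. *)
rewrite /hypercenter (prod_max_group (E := norm_series pi F G n)) //.
  apply/asboolP; split=> //.
  have [-> | ntE] := eqVneq (norm_series pi F G n : {set gT}) 1; [by left | right].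
  split=> // K L chKL sLE [p [p_pr pi_p pLK]].
  apply/central_factorP => //.
  have [||//] := @chief_norm_series pi F gT G K L n formF subF GSF chKL.
    rewrite (setIidPl sLE); case/andP: chKL => maxK _.
    exact: proper_subn (maxnormal_proper maxK).
  by move/pgroupP/(_ p p_pr pLK)/negP.
move=> N /asboolP[nsNG hypN].
apply: (@sub_norm_piF_fixpoint pi F gT G N _ formF subF nsNG nsEG); last first.
  have: norm_series pi F G n.+1 \subset norm_series pi F G n by rewrite -stabE.
  exact: id.
move=> K L chKL sLN; case: hypN => [N1 | [_ cenN]].
  by left; rewrite N1 in sLN; rewrite /pgroup (trivgP sLN) quotient1 cards1.
case: (boolP (pi^'.-group (L / K))) => [piLK | npi]; [by left | right].
move: npi; rewrite /pgroup /pnat cardG_gt0 => /allPn[p]; rewrite mem_primes => /and3P[p_pr _ pLK].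
rewrite inE negbK => pi_p; apply/(central_factorP chKL) => //.
by apply: cenN => //; exists p.
Qed.
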